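(* There exist a finite undirected graph $\mathcal{H}=(\mathcal{V},\mathcal{E})$, an infinite finitely generated group $G$ with generators $g_1,\ldots,g_n$, and vertices $v_{-n},\ldots,v_{-1},v_1,\ldots,v_n\in\mathcal{V}$ such that, for every absolutely continuous probability distribution $\mu$ on $\mathbb{R}$ and i.i.d. real random variables $\{\omega_g\}_{g\in G}$ with common distribution $\mu$, the random operator $H^\omega_G=\Delta_{\mathcal{H}_G}+\sum_{g\in G}\omega_gP_g$ on $\ell^2(\mathcal{H}_G)$ satisfies both of the following: (i) the group $Aut_{And}(\mathcal{H}_G)$ is trivial, i.e. the only graph automorphism $\phi$ of $\mathcal{H}_G$ with $U_\phi H^\omega_GU_\phi^\ast=H^\omega_G$ almost surely is the identity; (ii) almost surely, the point spectrum of $H^\omega_G$ has non-trivial multiplicity, i.e. $H^\omega_G$ has an eigenvalue of multiplicity at least $2$.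
   Context: Graphs are undirected without self-loops (edges are two-element subsets of the vertex set). Given a finitely generated group $G$ with generators $g_1,\ldots,g_n$, a finite undirected graph $\mathcal{H}=(\mathcal{V},\mathcal{E})$ and (not necessarily distinct) vertices $v_{-n},\ldots,v_{-1},v_1,\ldots,v_n\in\mathcal{V}$, the graph $\mathcal{H}_G=(\mathcal{V}_G,\mathcal{E}_G)$ has vertex set $\mathcal{V}_G=\mathcal{V}\times G$ and edge set $\mathcal{E}_G$ equal to the union of $$\{\{(v,g),(w,g)\}:\{v,w\}\in\mathcal{E},\ g\in G\}\quad\text{and}\quad\{\{(v_{-i},g),(v_i,gg_i)\}:g\in G,\ 1\leq i\leq n\}.$$ On $\ell^2(\mathcal{H}_G)=\ell^2(\mathcal{V}_G)$ the adjacency operator is $(\Delta_{\mathcal{H}_G}u)((v,h))=\sum_{\{(w,g),(v,h)\}\in\mathcal{E}_G}u((w,g))$, and for $g\in G$, $P_g$ is the projection $(P_gu)((v,h))=u((v,g))$ if $h=g$ and $0$ if $h\neq g$. The operator $H^\omega_G$ is the sum of a bounded self-adjoint operator and a real multiplication operator, taken self-adjoint on the natural (maximal) domain of the multiplication operator. For a graph automorphism $\phi$ of $\mathcal{H}_G$ (a bijection of $\mathcal{V}_G$ preserving edges and non-edges), $U_\phi$ is the unitary $(U_\phi u)((v,h))=u(\phi((v,h)))$ on $\ell^2(\mathcal{H}_G)$, and $$Aut_{And}(\mathcal{H}_G)=\{\phi\in Aut(\mathcal{H}_G):H^\omega_G=U_\phi H^\omega_GU_\phi^\ast\ \text{a.s.}\}.$$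 *)

(* Defs.v *)
From HB Require Import structures.
From mathcomp Require Import all_boot all_order all_algebra.
From mathcomp Require Import all_classical all_reals all_analysis.
From mathcomp Require Import complex.

Set Implicit Arguments.
Unset Strict Implicit.
Unset Printing Implicit Defensive.

Local Open Scope classical_set_scope.
Local Open Scope ring_scope.
Local Open Scope complex_scope.

(* Generation as a group: inverses of the generators are allowed. *)
Definition generates (G : groupType) (n : nat) (g : 'I_n -> G) : Prop :=
  forall S : {pred G}, group_closed S -> (forall i, g i \in S) ->
  forall x, x \in S.

(* [decorated_edge E g vm vp x y] says that the unordered pair {x, y} belongs
   to the edge set of H_G; [vm i] and [vp i] stand for v_{-i} and v_i.
   This is a set of pairs, so an edge arising in several ways counts once.
   Note that x = y can satisfy this relation when vm i = vp i and g i = 1. *)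
Definition decorated_edge (V : finType) (E : rel V) (G : groupType) (n : nat)
    (g : 'I_n -> G) (vm vp : 'I_n -> V) (x y : V * G) : Prop :=
  (E x.1 y.1 /\ x.2 = y.2) \/
  (exists i h,
     (x = (vm i, h) /\ y = (vp i, (h * g i)%g)) \/
     (y = (vm i, h) /\ x = (vp i, (h * g i)%g))).

Record graph_aut (T : Type) (e : T -> T -> Prop) := GraphAut {
  aut_fun :> T -> T;
  aut_inv : T -> T;
  aut_funK : cancel aut_fun aut_inv;
  aut_invK : cancel aut_inv aut_fun;
  aut_edge : forall x y, e (aut_fun x) (aut_fun y) <-> e x y }.

Section SquareSummable.
Context {R : realType} {T : choiceType}.

Definition ell2 : set (T -> R[i]) :=
  [set u | summable [set: T]
             (fun x => ((ComplexField.Normc.normc (u x)) ^+ 2)%:E)].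

(* A possibly unbounded operator on ell2: only the values of [op_fun] on
   [op_dom] are meaningful. *)
Record operator := Operator {
  op_dom : set (T -> R[i]);
  op_fun : (T -> R[i]) -> T -> R[i] }.

Definition eq_operator (A B : operator) : Prop :=
  op_dom A = op_dom B /\ {in op_dom A, forall u, op_fun A u = op_fun B u}.

Definition eigenspace_op (A : operator) (lambda : R[i]) : set (T -> R[i]) :=
  [set u | op_dom A u /\ op_fun A u = (fun x => lambda * u x)].

Definition lin_indep (m : nat) (u : 'I_m -> T -> R[i]) : Prop :=
  forall c : 'I_m -> R[i],
    (forall x, \sum_(k < m) c k * u k x = 0) -> forall k, c k = 0.

Definition multiplicity_ge (A : operator) (lambda : R[i]) (m : nat) : Prop :=
  exists u : 'I_m -> T -> R[i],
    (forall k, eigenspace_op A lambda (u k)) /\ lin_indep u.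

(* The sum is the finitely supported one; it is the true sum as soon as every
   vertex has finitely many neighbours, which is the case for H_G. *)
Definition adjacency (e : T -> T -> Prop) (u : T -> R[i]) : T -> R[i] :=
  fun x => \sum_(y \in [set y | e y x]) u y.

Context {e : T -> T -> Prop}.

Definition U_aut (phi : graph_aut e) (u : T -> R[i]) : T -> R[i] :=
  fun x => u (phi x).

(* U_phi is unitary, so its adjoint is composition with the inverse of phi. *)
Definition U_aut_adj (phi : graph_aut e) (u : T -> R[i]) : T -> R[i] :=
  fun x => u (aut_inv phi x).

(* U_phi A U_phi^* *)
Definition conj_aut (phi : graph_aut e) (A : operator) : operator :=
  Operator [set u | ell2 u /\ op_dom A (U_aut_adj phi u)]
           (fun u => U_aut phi (op_fun A (U_aut_adj phi u))).

End SquareSummable.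
Arguments operator : clear implicits.

Section Anderson.
Context {R : realType} {V : finType} {G : groupType}.

(* P_g *)
Definition fiber_proj (g : G) (u : V * G -> R[i]) : V * G -> R[i] :=
  fun x => if x.2 == g then u x else 0.

(* sum_g w_g P_g; at each x only the term g = x.2 can be nonzero. *)
Definition potential (w : G -> R) (u : V * G -> R[i]) : V * G -> R[i] :=
  fun x => \sum_(g \in [set: G]) (w g)%:C * fiber_proj g u x.

(* One realization of the random operator, on the maximal domain of the
   (possibly unbounded) multiplication operator. *)
Definition anderson (e : V * G -> V * G -> Prop) (w : G -> R) :
    operator R (V * G)%type :=
  Operator [set u | ell2 u /\ ell2 (potential w u)]
           (fun u x => adjacency e u x + potential w u x).

End Anderson.

Section Randomness.
Context {R : realType} {d : measure_display} {Omega : measurableType d}.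

(* Mutual independence with common distribution mu, over an arbitrary index
   set; the sequence s runs over the finite subfamilies. *)
Definition iid (P : probability Omega R) (I : choiceType)
    (mu : probability R R) (X : I -> {RV P >-> R}) : Prop :=
  (forall (s : seq I) (A : I -> set R), uniq s ->
     (forall i, measurable (A i)) ->
     P (\bigcap_(i in [set` s]) (X i @^-1` A i)) =
       (\prod_(i <- s) P (X i @^-1` A i))%E) /\
  (forall i (A : set R), measurable A -> distribution P (X i) A = mu A).

Definition aut_anderson (P : probability Omega R) (V : finType) (G : groupType)
    (e : V * G -> V * G -> Prop) (X : G -> {RV P >-> R}) : set (graph_aut e) :=
  [set phi | {ae P, forall t,
     eq_operator (anderson e (fun g => X g t))
                 (conj_aut phi (anderson e (fun g => X g t)))}].

End Randomness.

(* Main.v *)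
Require Import Defs.
From HB Require Import structures.
From mathcomp Require Import all_boot all_order all_algebra.
From mathcomp Require Import all_classical all_reals all_analysis.
From mathcomp Require Import complex.

Import Order.TTheory GRing.Theory Num.Theory.

Local Open Scope classical_set_scope.
Local Open Scope ring_scope.
Local Open Scope complex_scope.

(** Take G = Z with generator 1, and let H be the spider tree with one centre
    and three legs of 1, 3 and 5 vertices; both connecting vertices are the
    centre, so H_G is a two-way infinite path of centres, each carrying a
    spider.

    Multiplicity.  The adjacency matrix of the spider has a two-dimensional
    kernel, and its elements vanish at the centre: on a leg of odd length put
    the values 1, 0, -1, 0, ... starting next to the centre, and combine two
    legs so that the contributions at the centre cancel.  Extended by zero
    from one fiber, such a vector does not see the connecting edges, while the
    potential is a constant on the fiber.  Hence every omega_g is an eigenvalue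
    of multiplicity at least 2, for every realization
    ([multiplicity_fiber], [spider_null_funP]).

    Symmetry.  Comparing diagonal matrix entries, an automorphism phi that
    fixes the operator satisfies omega at phi(x) = omega at x
    ([aut_anderson_potential]).  If phi moved some x to another fiber, two
    distinct omega_g and omega_h would coincide almost surely, which is
    impossible for independent variables whose law is absolutely continuous
    ([iid_not_ae_eq]).  So phi preserves every fiber and induces on it an
    automorphism of the spider.  That is the identity because the legs have
    distinct lengths ([spider_rigid], [rigid_fiber_aut]): repeated eigenvalues
    do not require any symmetry. *)

(** * Finitely supported functions and the operator *)

Section FiniteSupport.
Context {R : realType}.

Lemma ell2_finite_support (T : choiceType) (r : seq T) (u : T -> R[i]) :
  (forall x, x \notin r -> u x = 0) -> ell2 u.
Proof.
move=> u0; rewrite /ell2 /= /summable.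
rewrite [X in (X < _)%E](_ : _ = \esum_(x in [set` r])
    `|((ComplexField.Normc.normc (u x)) ^+ 2)%:E|%E); last first.
  rewrite [RHS]esum_mkcond; apply: eq_esum => x _.
  case: ifPn => //; rewrite mem_setE => /u0 ->.
  by rewrite ComplexField.Normc.normc0 expr0n/= normr0.
rewrite esum_fset ?fsbig_finite//; try exact: finite_seq.
by apply: lte_sum_pinfty => x _; rewrite ltry.
Qed.

Context {V : finType} {G : groupType}.
Implicit Types (w : G -> R) (u : V * G -> R[i]) (e : V * G -> V * G -> Prop).

Lemma potentialE w u x : potential w u x = (w x.2)%:C * u x.
Proof.
rewrite /potential /fiber_proj (fsbigE [:: x.2])//=.
  by rewrite big_cons big_nil in_setT eqxx addr0.
by move=> g _; rewrite inE eq_sym => /negPf ->; rewrite mulr0.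
Qed.

(** The domain restricts only the behaviour at infinity, however unbounded
    the potential is. *)
Lemma anderson_dom_finite_support e w (r : seq (V * G)) u :
  (forall x, x \notin r -> u x = 0) -> op_dom (anderson e w) u.
Proof.
move=> u0; split; apply: (@ell2_finite_support _ r) => // x /u0 ux0.
by rewrite potentialE ux0 mulr0.
Qed.

Definition delta_fun (x : V * G) : V * G -> R[i] := fun y => (y == x)%:R.

Lemma anderson_delta_diag e w x : ~ e x x ->
  op_fun (anderson e w) (delta_fun x) x = (w x.2)%:C.
Proof.
move=> exx; rewrite /= potentialE /delta_fun eqxx mulr1 /adjacency fsbig1 ?add0r//.
by move=> y /= eyx; case: eqP => // yx; rewrite yx in eyx.
Qed.

(** Conjugating by U_phi moves the diagonal entry at [phi x] to [x]; without
    loops these entries are the values of the potential. *)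
Lemma aut_anderson_potential e w (phi : graph_aut e) :
    (forall x, ~ e x x) ->
    eq_operator (anderson e w) (conj_aut phi (anderson e w)) ->
  forall x, w (phi x).2 = w x.2.
Proof.
move=> loopless [_ eqfun] x.
have dom_delta : delta_fun x \in op_dom (anderson e w).
  rewrite inE; apply: (@anderson_dom_finite_support _ _ [:: x]) => y.
  by rewrite inE /delta_fun => /negPf ->.
have : op_fun (anderson e w) (delta_fun x) x =
    op_fun (anderson e w) (U_aut_adj phi (delta_fun x)) (phi x).
  by rewrite eqfun.
rewrite anderson_delta_diag//.
have -> : U_aut_adj phi (delta_fun x) = delta_fun (phi x).
  apply/funext => y; rewrite /U_aut_adj /delta_fun.
  by rewrite -(inj_eq (can_inj (aut_funK phi))) aut_invK.
by rewrite anderson_delta_diag// => /complexI ->.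
Qed.

Lemma aut_anderson_id e w (phi : graph_aut e) :
  phi =1 id -> eq_operator (anderson e w) (conj_aut phi (anderson e w)).
Proof.
move=> phi1.
have Uadj u : U_aut_adj phi u = u.
  by apply/funext => x; rewrite /U_aut_adj -{1}[x]phi1 aut_funK.
split.
  by apply/seteqP; split=> u /=; rewrite Uadj; [case|case].
by move=> u _; rewrite /conj_aut [RHS]/= Uadj /U_aut; apply/funext => x; rewrite phi1.
Qed.

(** * Eigenfunctions supported on one fiber *)

Definition fiber_fun (g : G) (f : V -> R[i]) : V * G -> R[i] :=
  fun x => if x.2 == g then f x.1 else 0.

Lemma fiber_fun_support g f x :
  x \notin [seq (v, g) | v <- enum V] -> fiber_fun g f x = 0.
Proof.
case: x => v h; rewrite /fiber_fun/=; case: eqP => // ->.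
by rewrite map_f// mem_enum.
Qed.

(** A connecting edge can only transport the values of [f] at the attaching
    vertices, and these are zero. *)
Lemma adjacency_fiber_fun (E : rel V) (n : nat) (gen : 'I_n -> G)
    (vm vp : 'I_n -> V) (g : G) (f : V -> R[i]) (kappa : R[i]) :
    (forall i, f (vm i) = 0) -> (forall i, f (vp i) = 0) ->
    (forall v, \sum_(w | E w v) f w = kappa * f v) ->
  adjacency (decorated_edge E gen vm vp) (fiber_fun g f) =
  fun x => kappa * fiber_fun g f x.
Proof.
move=> fm0 fp0 fE; apply/funext => -[v h]; rewrite /adjacency.
have [->|hg] := eqVneq h g; last first.
  rewrite [fiber_fun g f (v, h)]/fiber_fun/= (negPf hg) mulr0 fsbig1//= => -[w k] /=.
  rewrite /fiber_fun/=; case: eqP => // -> [[/= _ gh]|].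
    by rewrite -gh eqxx in hg.
  by case=> i [k' [[[-> _] _]|[_ [-> _]]]].
rewrite [fiber_fun g f (v, g)]/fiber_fun/= eqxx -fE.
rewrite (fsbigE [seq (v', g) | v' <- enum (E^~ v)])/=.
- rewrite big_map big_enum_cond/=; apply: eq_big => [v'|v' _].
    by apply/andb_idr => Ev; rewrite inE; left.
  by rewrite /fiber_fun/= eqxx.
- by rewrite map_inj_uniq ?enum_uniq// => ? ? [].
- by move=> _ /mapP[v' + ->]; rewrite mem_enum => Ev; left.
move=> [w k] /=; rewrite /fiber_fun/= => edge.
case: eqP => // kg; subst k; move: edge => [[/= wv _]|].
  by rewrite map_f// mem_enum.
by case=> i [k' [[[-> _] _]|[_ [-> _]]]].
Qed.

(** The potential acts on the fiber over [g] as the scalar [w g], so it shifts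
    the eigenvalue of the finite graph without splitting it. *)
Lemma multiplicity_fiber (E : rel V) (n : nat) (gen : 'I_n -> G)
    (vm vp : 'I_n -> V) (w : G -> R) (g : G) (m : nat)
    (f : 'I_m -> V -> R[i]) (kappa : R[i]) :
    (forall k i, f k (vm i) = 0) -> (forall k i, f k (vp i) = 0) ->
    (forall k v, \sum_(v' | E v' v) f k v' = kappa * f k v) ->
    lin_indep f ->
  multiplicity_ge (anderson (decorated_edge E gen vm vp) w)
                  (kappa + (w g)%:C) m.
Proof.
move=> fm0 fp0 fE indep; exists (fun k => fiber_fun g (f k)); split.
  move=> k; split.
    by apply: anderson_dom_finite_support => x; apply: fiber_fun_support.
  apply/funext => x /=; rewrite (adjacency_fiber_fun _ _ _ _ _ _ _ kappa)//.
  rewrite potentialE -mulrDl /fiber_fun.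
  by case: eqP => [->//|]; rewrite !mulr0.
move=> c c0; apply: indep => v; rewrite -[RHS](c0 (v, g)).
by apply: eq_bigr => k _; rewrite /fiber_fun/= eqxx.
Qed.

End FiniteSupport.

(** * Independent variables with an absolutely continuous law *)

Section Probability.
Context {R : realType}.

(** A law on the line with only the values 0 and 1 is concentrated at a point:
    each rational cuts off one half-line of measure 0, these countably many
    half-lines together are null, and they cover all points but at most one.
    Lebesgue measure does not charge that point. *)
Lemma abs_cont_not_zero_one (mu : probability R R) :
    mu `<< (@lebesgue_measure R) ->
  ~ forall A : set R, measurable A -> mu A = 0%E \/ mu A = 1%E.
Proof.
move=> /null_content_dominatesP dom zo.
have [r r_surj] : exists r : nat -> rat, forall q, exists k, r k = q.
  by exists (odflt 0 \o unpickle) => q; exists (pickle q); rewrite /comp pickleK.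
pose N (I : rat -> interval R) k :=
  if mu [set` I (r k)] == 0%E then [set` I (r k)] else set0.
have negN I : mu.-negligible (\bigcup_k N I k).
  apply: negligible_bigcup => k; rewrite /N.
  case: eqP => [Iq0|_]; last exact: negligible_set0.
  by apply/negligibleP => //; exact: measurable_itv.
have inN (I : rat -> interval R) q x :
    mu [set` I q] = 0%E -> x \in I q -> (\bigcup_k N I k) x.
  by have [k <-] := r_surj q => Iq0 xI; exists k => //; rewrite /N Iq0 eqxx.
(* The union of the null left half-lines and that of the null right ones. *)
pose L := \bigcup_k N (fun q => `]-oo, ratr q]) k.
pose U := \bigcup_k N (fun q => `]ratr q, +oo[) k.
have sub1 x y : ~ (L `|` U) x -> ~ (L `|` U) y -> ~ x < y.
  move=> /not_orP[nLx _] /not_orP[_ nUy] /rat_in_itvoo[q].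
  rewrite in_itv/= => /andP[xq qy].
  have [q0|q1] := zo `]-oo, ratr q]%classic (measurable_itv _).
    by apply: nLx; apply: (inN _ q); rewrite // in_itv/= ltW.
  apply: nUy; apply: (inN _ q); last by rewrite in_itv/= qy.
  rewrite -setCitvl probability_setC; last exact: measurable_itv.
  by rewrite [X in (_ - X)%E]q1 subee.
have negC : mu.-negligible (~` (L `|` U)).
  have [[x xC]|/forallNP C0] := pselect (exists x, ~ (L `|` U) x); last first.
    apply: (negligibleS _ (negligible_set0 mu)) => x xC.
    exact: C0 xC.
  exists [set x]; split => //; first by apply: dom => //; exact: lebesgue_measure_set1.
  move=> y yC /=; apply/eqP; rewrite eq_le !leNgt.
  by apply/andP; split; apply/negP; apply: sub1.
have negLU : mu.-negligible (L `|` U) by apply: negligibleU; exact: negN.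
have := negligibleU negLU negC.
rewrite setUv => /(negligibleP mu measurableT).
by rewrite [X in X = _](@probability_setT _ _ _ mu) => /eqP; rewrite onee_eq0.
Qed.

(** If the two variables agree almost surely, then independence gives
    mu A = mu A * mu A for every A, a zero-one law. *)
Lemma iid_not_ae_eq (mu : probability R R) (d : measure_display)
    (Omega : measurableType d) (P : probability Omega R) (I : choiceType)
    (X : I -> {RV P >-> R}) (i j : I) :
    mu `<< (@lebesgue_measure R) -> iid mu X -> i != j ->
  ~ {ae P, forall t, X i t = X j t}.
Proof.
move=> mu_ac [indep distr] ij Xij.
apply: (abs_cont_not_zero_one mu mu_ac) => A mA.
have PA k : P (X k @^-1` A) = mu A by rewrite -(distr k).
have mX k : measurable (X k @^-1` A).
  by rewrite -[X in measurable X]setTI; exact: measurable_funP.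
have := indep [:: i; j] (fun=> A).
rewrite /= inE ij => /(_ erefl (fun=> mA)).
rewrite !big_cons big_nil mule1 !PA.
have -> : \bigcap_(k in [set` [:: i; j]]) X k @^-1` A =
    (X i @^-1` A) `&` (X j @^-1` A).
  by rewrite bigcap_seq !big_cons big_nil setIT.
set B := _ `&` _; have mB : measurable B by exact: measurableI.
have -> : P B = mu A.
  rewrite -(PA i); apply/eqP; rewrite eq_le; apply/andP; split.
    by apply: le_measure; rewrite ?inE//; exact: subIsetl.
  case: Xij => N [mN N0 subN].
  have -> : P B = (P B + P N)%E by rewrite N0 adde0.
  apply: le_trans (measureU2 _ _ _) => //.
  apply: le_measure; rewrite ?inE//; first exact: measurableU.
  move=> t Xit; have [tN|tN] := pselect (N t); [by right|left; split=> //].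
  have Xijt : X i t = X j t by apply: contrapT => Xijt; apply/tN/subN.
  by rewrite /preimage/= -Xijt.
have /fineK <- : mu A \is a fin_num by apply: fin_num_measure.
move=> /eqP; rewrite -EFinM eqe -subr_eq0 -{1}[fine _]mulr1 -mulrBr mulf_eq0.
rewrite subr_eq0 => /orP[/eqP ->|/eqP <-]; by [left|right].
Qed.

End Probability.

(** * Rigidity of the finite graph and of the decorated graph *)

Section Rigidity.
Context {V : finType}.
Implicit Types (E : rel V).

Definition rigid E := forall sigma : V -> V, injective sigma ->
  (forall x y, E (sigma x) (sigma y) = E x y) -> sigma =1 id.

Definition neighbour_sum E (c : V -> nat) (x : V) : nat :=
  (\sum_(y | E x y) c y)%N.

(** Iterating [neighbour_sum] on the constant 1 counts the walks of length [k]
    starting at each vertex.  Automorphisms preserve this number, so they are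
    trivial as soon as it tells all vertices apart. *)
Lemma rigid_walk_count E (k : nat) :
  injective (iter k (neighbour_sum E) (fun=> 1%N)) -> rigid E.
Proof.
move=> inj sigma sigma_inj sigmaE x; apply: inj.
elim: k x => [//|k IHk] x.
rewrite !iterS /neighbour_sum (reindex_inj sigma_inj)/=.
by apply: eq_big => [y|y _]; rewrite ?sigmaE// IHk.
Qed.

Context {G : groupType}.

(** A connecting edge inside a fiber would need h = h * gen i. *)
Lemma decorated_edge_fiber E (n : nat) (gen : 'I_n -> G) (vm vp : 'I_n -> V)
    (x y : V) (g : G) :
    (forall i, gen i <> 1%g) ->
  decorated_edge E gen vm vp (x, g) (y, g) <-> E x y.
Proof.
move=> gen1; split; last by left.
case=> [[]//|[i [h edge]]]; case: (gen1 i).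
by case: edge => -[[_ ->]] [_ /esym/(canRL (mulKg _))]; rewrite mulVg.
Qed.

Lemma rigid_fiber_aut E (n : nat) (gen : 'I_n -> G) (vm vp : 'I_n -> V)
    (phi : graph_aut (decorated_edge E gen vm vp)) :
    rigid E -> (forall i, gen i <> 1%g) -> (forall x, (phi x).2 = x.2) ->
  phi =1 id.
Proof.
move=> rigE gen1 phi2 [x g].
have phiE y : phi (y, g) = ((phi (y, g)).1, g).
  by rewrite -[RHS]/(_, (y, g).2) -phi2 -surjective_pairing.
rewrite phiE; congr pair; apply: (rigE (fun y => (phi (y, g)).1)).
  move=> y z yz; have : phi (y, g) = phi (z, g) by rewrite phiE yz -phiE.
  by move=> /(can_inj (aut_funK phi))[].
move=> y z; apply/idP/idP.
  move=> /(decorated_edge_fiber _ _ _ vm vp _ _ g gen1).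
  by rewrite -!phiE => /aut_edge/decorated_edge_fiber; apply.
move=> /(decorated_edge_fiber _ _ _ vm vp _ _ g gen1)/(aut_edge phi).
by rewrite phiE [phi (z, g)]phiE => /decorated_edge_fiber; apply.
Qed.

End Rigidity.

(** * The spider with legs of 1, 3 and 5 vertices *)

Section Spider.

(** Vertex 0 is the centre; the legs are 1, then 2-3-4, then 5-6-7-8-9, each
    listed from the centre outwards.  The entry 0 for the centre itself is a
    dummy, excluded in [spider_child]. *)
Definition spider_parent : seq nat := [:: 0; 0; 0; 2; 3; 0; 5; 6; 7; 8]%N.

Definition spider_child (x y : nat) : bool :=
  (0 < x)%N && (y == nth 0%N spider_parent x).

Definition spider_rel (x y : nat) : bool := spider_child x y || spider_child y x.

Definition spider : rel 'I_10 := fun x y => spider_rel x y.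

Lemma spider_sym : symmetric spider.
Proof. by move=> x y; exact: orbC. Qed.

Lemma spider_irr : irreflexive spider.
Proof.
move=> x; apply/negP.
have : all (fun x => ~~ spider_rel x x) (iota 0 10) by [].
by move=> /allP/(_ x); rewrite mem_iota ltn_ord => /(_ isT)/negP.
Qed.

(** Five is the least length for which the ten walk counts are pairwise
    distinct. *)
Lemma spider_rigid : rigid spider.
Proof.
apply: (@rigid_walk_count _ _ 5).
pose step (c : nat -> nat) x := (\sum_(0 <= y < 10 | spider_rel x y) c y)%N.
have walksE k (x : 'I_10) : iter k (neighbour_sum spider) (fun=> 1%N) x =
    iter k step (fun=> 1%N) x.
  elim: k x => [//|k IHk] x; rewrite !iterS /step big_mkord.
  by apply: eq_bigr => y _; rewrite IHk.
have /mkseq_uniqP inj : uniq (mkseq (iter 5 step (fun=> 1%N)) 10).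
  by rewrite /step unlock; vm_compute.
by move=> x y; rewrite !walksE => /inj xy; apply/val_inj/xy; exact: ltn_ord.
Qed.

(** The vector 1, 0, -1, 0, ... on the shortest leg minus the same vector on
    each of the other two legs. *)
Definition spider_null : seq (seq int) :=
  [:: [:: 0; 1; -1; 0; 1; 0; 0; 0; 0; 0]; [:: 0; 1; 0; 0; 0; -1; 0; 1; 0; -1]].

Definition spider_null_fun (R : realType) (k : 'I_2) (v : 'I_10) : R[i] :=
  (nth 0 (nth [::] spider_null k) v)%:~R.

Lemma spider_null_funP (R : realType) (k : 'I_2) (v : 'I_10) :
  \sum_(y | spider y v) spider_null_fun R k y = 0.
Proof.
rewrite /spider_null_fun -rmorph_sum/=.
have : all (fun k => all (fun v => \sum_(0 <= y < 10 | spider_rel y v)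
    nth 0 (nth [::] spider_null k) y == 0) (iota 0 10)) (iota 0 2).
  by rewrite unlock; vm_compute.
move=> /allP/(_ k); rewrite mem_iota ltn_ord => /(_ isT).
move=> /allP/(_ v); rewrite mem_iota ltn_ord => /(_ isT)/eqP.
by rewrite big_mkord => ->.
Qed.

Lemma spider_null_fun_center (R : realType) (k : 'I_2) :
  spider_null_fun R k ord0 = 0.
Proof. by case: k => -[|[|//]]. Qed.

Lemma spider_null_fun_indep (R : realType) : lin_indep (spider_null_fun R).
Proof.
move=> c c0.
(* Vertices 2 and 5 start the two longer legs; each lies in the support of
   exactly one of the two vectors. *)
have := c0 (inord 2); have := c0 (inord 5).
rewrite !big_ord_recl !big_ord0 /spider_null_fun /= !inordK//= !mulr0 !addr0 !add0r.
move=> /eqP; rewrite mulrN1 oppr_eq0 => /eqP c1.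
move=> /eqP; rewrite mulrN1 oppr_eq0 => /eqP c0'.
by case=> -[|[|//]] lt2; [rewrite -[RHS]c0'|rewrite -[RHS]c1]; congr c; exact: val_inj.
Qed.

End Spider.

(** * The infinite cyclic group *)

(** The additive group of the integers in multiplicative notation; the alias
    keeps this structure apart from the ring product on [int]. *)
Definition Zmul : Type := int.
HB.instance Definition _ := Choice.on Zmul.
HB.instance Definition _ := isGroup.Build Zmul
  (@addrA int) (@add0r int) (@addr0 int) (@addNr int) (@addrN int).

Lemma Zmul_infinite : infinite_set [set: Zmul].
Proof.
apply/infiniteP; have -> : [set: nat] = absz @` [set: int].
  by apply/seteqP; split=> [n _|//]; exists n%:Z.
exact: card_image_le.
Qed.

Lemma Zmul_generated : generates (fun _ : 'I_1 => (1%R : int) : Zmul).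
Proof.
move=> S Sgrp /(_ ord0) S1.
have SP (n : nat) : (n%:Z : Zmul) \in S.
  elim: n => [|n IHn]; first by case: Sgrp.
  have -> : (n.+1%:Z : Zmul) = (((1%R : int) : Zmul) * (n%:Z : Zmul))%g by [].
  exact: group_closedM IHn.
case=> n; first exact: SP.
have -> : (Negz n : Zmul) = ((n.+1%:Z : Zmul)^-1)%g by [].
exact: group_closedV (SP n.+1).
Qed.

(** * Degenerate spectrum without symmetry *)

Theorem mainTheorem2 (R : realType) :
  exists (V : finType) (E : rel V) (G : groupType) (n : nat)
         (g : 'I_n -> G) (vm vp : 'I_n -> V),
    let HG := decorated_edge E g vm vp in
    [/\ symmetric E, irreflexive E,
        infinite_set [set: G], generates g & forall x, ~ HG x x] /\
    forall mu : probability R R, mu `<< (@lebesgue_measure R) ->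
    forall (d : measure_display) (Omega : measurableType d)
           (P : probability Omega R) (omega : G -> {RV P >-> R}),
      iid mu omega ->
      (forall phi : graph_aut HG, aut_anderson omega phi <-> phi =1 id) /\
      {ae P, forall t, exists lambda : R[i],
         multiplicity_ge (anderson HG (fun h => omega h t)) lambda 2}.
Proof.
pose gen := fun _ : 'I_1 => (1%R : int) : Zmul.
pose center := fun _ : 'I_1 => ord0 : 'I_10.
have gen1 i : gen i <> 1%g by [].
have loopless x : ~ decorated_edge spider gen center center x x.
  by case: x => v h /(decorated_edge_fiber _ _ _ _ _ _ _ _ gen1); rewrite spider_irr.
exists 'I_10, spider, Zmul, 1%N, gen, center, center => HG; split.
  split=> //; [exact: spider_sym|exact: spider_irr|exact: Zmul_infinite|
    exact: Zmul_generated].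
move=> mu mu_ac d Omega P omega iid_omega; split.
  move=> phi; split=> [phiP|phi1]; last by apply: aeW => t; exact: aut_anderson_id.
  apply: rigid_fiber_aut => //; first exact: spider_rigid.
  move=> x; apply: contrapT => /eqP phix.
  apply: (iid_not_ae_eq mu _ _ _ _ _ _ _ mu_ac iid_omega phix).
  apply: filterS phiP => t /aut_anderson_potential; exact.
apply: aeW => t; exists (0 + (omega 1%g t)%:C).
apply: (multiplicity_fiber _ _ _ _ _ _ _ _ (spider_null_fun R)).
- by move=> k i; exact: spider_null_fun_center.
- by move=> k i; exact: spider_null_fun_center.
- by move=> k v; rewrite mul0r spider_null_funP.
exact: spider_null_fun_indep.
Qed.
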